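(* For every $n\ge 1$, $$Z_n(1;\alpha,\beta,\gamma,\delta;1)=\prod_{j=0}^{n-1}\big(\alpha+\beta+\gamma+\delta+j(\alpha+\gamma)(\beta+\delta)\big).$$
   Context: A staircase tableau of size $n$ is a filling of the Young diagram of staircase shape $(n,n-1,\dots,1)$ (English convention: row $r$ consists of columns $1,\dots,n+1-r$; the diagonal boxes are the last boxes of the rows) in which each box is empty or labeled by one of $\alpha,\beta,\gamma,\delta$, such that: no diagonal box is empty; every box in the same row and to the left of a $\beta$ or a $\delta$ is empty; every box in the same column and above an $\alpha$ or a $\gamma$ is empty. The type of $T$ is the word in $\{\bullet,\circ\}^n$ obtained by reading the diagonal boxes from northeast to southwest, writing $\bullet$ for $\alpha$ or $\delta$ and $\circ$ for $\beta$ or $\gamma$. Each empty box is assigned $q$ or $1$ according to the nearest labeled box to its right in its row and the nearest labeled box below it in its column: it gets $1$ if it sees a $\beta$ to its right; $q$ if it sees a $\delta$ to its right; $1$ if it sees an $\alpha$ or $\gamma$ to its right and an $\alpha$ or $\delta$ below it; $q$ if it sees an $\alpha$ or $\gamma$ to its right and a $\beta$ or $\gamma$ below it. The weight $\mathrm{wt}(T)$ is the product of all labels $\alpha,\beta,\gamma,\delta$ in $T$ and all assigned $q$'s. Let $t(T)$ be the number of $\bullet$'s in the type of $T$, and $Z_n(y;\alpha,\beta,\gamma,\delta;q)=\sum_T \mathrm{wt}(T)\,y^{t(T)}$, summed over all staircase tableaux of size $n$. *)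

(* Defs.v *)
From HB Require Import structures.
From mathcomp Require Import all_boot all_order all_algebra.

Set Implicit Arguments.
Unset Strict Implicit.
Unset Printing Implicit Defensive.

Import GRing.Theory.
Local Open Scope ring_scope.

Inductive label := Alpha | Beta | Gamma | Delta.

Definition label_code (l : label) : bool * bool :=
  match l with
  | Alpha => (false, false)
  | Beta => (false, true)
  | Gamma => (true, false)
  | Delta => (true, true)
  end.

Definition label_decode (p : bool * bool) : label :=
  match p with
  | (false, false) => Alpha
  | (false, true) => Beta
  | (true, false) => Gamma
  | (true, true) => Delta
  end.

Lemma label_codeK : cancel label_code label_decode.
Proof. by case. Qed.

HB.instance Definition _ := Finite.copy label (can_type label_codeK).

(* Rows and columns are numbered from 0, rows downwards and columns rightwards:
   row i consists of the columns 0, ..., n - 1 - i. *)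
Definition in_staircase (n : nat) (p : 'I_n * 'I_n) : bool :=
  (p.1 + p.2 < n)%N.

Definition box (n : nat) := {p : 'I_n * 'I_n | in_staircase p}.

Definition brow n (b : box n) : nat := (val b).1.
Definition bcol n (b : box n) : nat := (val b).2.

Definition on_diagonal n (b : box n) : bool := (brow b + bcol b == n.-1)%N.

(* None is the empty box *)
Definition filling (n : nat) := {ffun box n -> option label}.

(* Content of the box in row i and column j; None outside the diagram. *)
Definition entry n (T : filling n) (i j : nat) : option label :=
  if [pick b : box n | (brow b == i) && (bcol b == j)] is Some b
  then T b else None.

Definition is_staircase_tableau n (T : filling n) : bool :=
  [&& [forall b, on_diagonal b ==> (T b != None)],
      [forall b, forall b',
         [&& brow b' == brow b, (bcol b' < bcol b)%N
           & T b \in [:: Some Beta; Some Delta]]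
         ==> (T b' == None)]
    & [forall b, forall b',
         [&& bcol b' == bcol b, (brow b' < brow b)%N
           & T b \in [:: Some Alpha; Some Gamma]]
         ==> (T b' == None)]].

(* Label of the nearest nonempty box to the right of (resp. below) b; None if
   there is no such box. *)
Definition sees_right n (T : filling n) (b : box n) : option label :=
  ohead (pmap (entry T (brow b)) (iota (bcol b).+1 (n - (bcol b).+1))).

Definition sees_below n (T : filling n) (b : box n) : option label :=
  ohead (pmap (entry T ^~ (bcol b)) (iota (brow b).+1 (n - (brow b).+1))).

Section Weight.

Variables (R : comNzRingType) (y alpha beta gamma delta q : R).

Definition label_val (l : label) : R :=
  match l with
  | Alpha => alpha
  | Beta => beta
  | Gamma => gamma
  | Delta => delta
  end.

(* The last case does not occur for an empty box of a staircase tableau: the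
   diagonal boxes are labeled, so such a box sees a label in both directions. *)
Definition empty_val (right below : option label) : R :=
  match right, below with
  | Some Beta, _ => 1
  | Some Delta, _ => q
  | Some (Alpha | Gamma), Some (Alpha | Delta) => 1
  | Some (Alpha | Gamma), Some (Beta | Gamma) => q
  | _, _ => 1
  end.

Definition wt n (T : filling n) : R :=
  \prod_(b : box n)
    match T b with
    | Some l => label_val l
    | None => empty_val (sees_right T b) (sees_below T b)
    end.

(* In a type, true stands for a black dot and false for a white one. *)
Definition staircase_type n (T : filling n) : n.-tuple bool :=
  [tuple entry T i (n.-1 - i) \in [:: Some Alpha; Some Delta] | i < n].

Definition nb_bullets n (T : filling n) : nat := count id (staircase_type T).

Definition Z (n : nat) : R :=
  \sum_(T : filling n | is_staircase_tableau T) wt T * y ^+ nb_bullets T.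

End Weight.

(* Main.v *)
(* At q = y = 1 only the sums a = alpha + gamma and b = beta + delta matter.
   Call a row free if it contains neither beta nor delta, and let G_n(z) be the
   sum of the weights of the tableaux of size n, each multiplied by z to the
   number of free rows.  A tableau of size n+1 is a tableau of size n together
   with a new leftmost column, whose labels above its diagonal box must lie in
   free rows.  Filling this column from the bottom upwards over k free rows
   contributes (b + a z) (z + b)^k, so that G_{n+1}(z) = (b + a z) G_n(z + b),
   and the formula is the value of G_n at z = 1. *)

Require Import Defs.
From HB Require Import structures.
From mathcomp Require Import all_boot all_order all_algebra.
From mathcomp Require Import ring.

Set Implicit Arguments.
Unset Strict Implicit.
Unset Printing Implicit Defensive.

Import GRing.Theory.
Local Open Scope ring_scope.

Definition blocks_up (x : option label) := x \in [:: Some Alpha; Some Gamma].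
Definition blocks_left (x : option label) := x \in [:: Some Beta; Some Delta].

Lemma sum_option_label (R : nmodType) (F : option label -> R) :
  \sum_x F x = F None + F (Some Alpha) + F (Some Beta) + F (Some Gamma)
               + F (Some Delta).
Proof.
rewrite (bigD1 None) //= (bigD1 (Some Alpha)) //= (bigD1 (Some Beta)) //=.
rewrite (bigD1 (Some Gamma)) //= (bigD1 (Some Delta)) //= big1 ?addr0 ?addrA //.
by case=> [[]|].
Qed.

(** * Columns built up by adding a bottom box *)

Section Column.

Variable m : nat.

(** Rows are numbered downwards, so [x] goes below all of [c]. Only in this position can a single
    label force the whole remaining column to be empty, which is what makes induction on the height
    work. *)
Definition extend_column (D : Type) (c : {ffun 'I_m -> D}) (x : D) :
    {ffun 'I_m.+1 -> D} :=
  [ffun i => if unlift ord_max i is Some j then c j else x].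

Lemma extend_column_widen D (c : {ffun 'I_m -> D}) x j :
  extend_column c x (widen_ord (leqnSn m) j) = c j.
Proof.
rewrite ffunE; have -> : widen_ord (leqnSn m) j = lift ord_max j.
  by apply: val_inj; rewrite /= /bump leqNgt ltn_ord.
by rewrite liftK.
Qed.

Lemma extend_column_max D (c : {ffun 'I_m -> D}) x :
  extend_column c x ord_max = x.
Proof. by rewrite ffunE unlift_none. Qed.

Lemma sum_extend_column (R : nmodType) (D : finType)
    (F : {ffun 'I_m.+1 -> D} -> R) :
  \sum_c F c = \sum_c \sum_x F (extend_column c x).
Proof.
rewrite pair_big /= (reindex (fun p => extend_column p.1 p.2)) //=.
exists (fun c => ([ffun j => c (widen_ord (leqnSn m) j)], c ord_max)) => c _ /=.
  case: c => c x /=; rewrite extend_column_max; congr (_, _).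
  by apply/ffunP=> j; rewrite ffunE extend_column_widen.
apply/ffunP=> i; case: (unliftP ord_max i) => [j ->|->].
  have -> : lift ord_max j = widen_ord (leqnSn m) j.
    by apply: val_inj; rewrite /= /bump leqNgt ltn_ord.
  by rewrite extend_column_widen ffunE.
by rewrite extend_column_max.
Qed.

End Column.

Lemma forall_big_andE (I : finType) (P : pred I) :
  [forall i, P i] = \big[andb/true]_i P i.
Proof. by rewrite big_andE. Qed.

Lemma forall_ord_recr m (P : pred 'I_m.+1) :
  [forall i, P i] = [forall i, P (widen_ord (leqnSn m) i)] && P ord_max.
Proof. by rewrite !forall_big_andE big_ord_recr. Qed.

(** The condition on the diagonal box is kept apart, because it is lost once the bottom box is
    removed. The predicate [fr] lives on [nat] so that it stays the same when [m] changes. *)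
Definition column_ok m (fr : nat -> bool) (c : {ffun 'I_m -> option label}) :=
  [forall i : 'I_m, (c i != None) ==> fr i]
  && [forall k : 'I_m, forall i : 'I_m,
        (i < k)%N && blocks_up (c k) ==> (c i == None)].

Lemma column_ok_extend m fr (c : {ffun 'I_m -> option label}) x :
  column_ok fr (extend_column c x) =
  [&& (x != None) ==> fr m, blocks_up x ==> (c == [ffun => None])
    & column_ok fr c].
Proof.
rewrite /column_ok !forall_ord_recr extend_column_max /=.
under eq_forallb => i do rewrite extend_column_widen.
have -> : [forall k : 'I_m, forall i : 'I_m.+1,
             (i < widen_ord (leqnSn m) k)%N
               && blocks_up (extend_column c x (widen_ord (leqnSn m) k))
             ==> (extend_column c x i == None)]
          = [forall k : 'I_m, forall i : 'I_m,
               (i < k)%N && blocks_up (c k) ==> (c i == None)].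
  apply: eq_forallb => k.
  rewrite forall_ord_recr /= ltnNge (ltnW (ltn_ord k)) /= andbT.
  by apply: eq_forallb => i; rewrite !extend_column_widen.
rewrite ltnn /= andbT.
have -> : [forall i : 'I_m, (i < m)%N && blocks_up x
             ==> (extend_column c x (widen_ord (leqnSn m) i) == None)]
          = (blocks_up x ==> (c == [ffun => None])).
  case: (blocks_up x) => /=; last by apply/forallP => i; rewrite andbF.
  apply/forallP/eqP => [h|-> i]; last by rewrite extend_column_widen ffunE eqxx implybT.
  apply/ffunP=> i; have := h i.
  by rewrite extend_column_widen ltn_ord ffunE => /eqP.
by rewrite -!andbA; do !bool_congr.
Qed.

(** * The weighted sum over one column *)

Section AtOne.

Variables (R : comNzRingType) (alpha beta gamma delta : R).

Local Notation a := (alpha + gamma).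
Local Notation b := (beta + delta).

Definition content_val (x : option label) : R :=
  oapp (label_val alpha beta gamma delta) 1 x.

(* A row that stays free after receiving [x] in the new column contributes z. *)
Definition cell_val (z : R) (free : bool) (x : option label) : R :=
  content_val x * (if free && ~~ blocks_left x then z else 1).

Definition column_sum (z : R) m (fr : nat -> bool) : R :=
  \sum_(c : {ffun 'I_m -> option label} | column_ok fr c)
     \prod_(i < m) cell_val z (fr i) (c i).

Definition free_prod (z : R) m (fr : nat -> bool) : R :=
  \prod_(i < m) (if fr i then z else 1).

Lemma column_ok_empty m fr :
  column_ok fr ([ffun => None] : {ffun 'I_m -> option label}).
Proof.
apply/andP; split; first by apply/forallP=> i; rewrite ffunE.
by apply/forallP=> k; apply/forallP=> i; rewrite !ffunE implybT.
Qed.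

(** The predicate [Q] lets one computation serve both an arbitrary bottom box and a diagonal one,
    which must be labeled. *)
Lemma sum_column_extend z m fr (Q : pred (option label)) :
  \sum_(c : {ffun 'I_m.+1 -> option label} | column_ok fr c && Q (c ord_max))
     \prod_(i < m.+1) cell_val z (fr i) (c i) =
  \sum_(x | ((x != None) ==> fr m) && Q x) cell_val z (fr m) x *
     (if blocks_up x then free_prod z m fr else column_sum z m fr).
Proof.
rewrite big_mkcond sum_extend_column exchange_big [RHS]big_mkcond.
apply: eq_bigr => x _.
under eq_bigr => c _.
  rewrite column_ok_extend extend_column_max big_ord_recr extend_column_max /=.
  under eq_bigr => i _ do rewrite extend_column_widen.
  over.
case: (Q x); rewrite ?andbF /=; last by rewrite big1 // => c _; rewrite andbF.
rewrite andbT; case: (_ ==> _); last by rewrite big1.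
rewrite -big_mkcond -big_distrl /= mulrC; congr (_ * _).
case: (blocks_up x) => /=; last by apply: eq_bigl => c; rewrite andbT.
(* Under an alpha or a gamma only the empty column survives, and it leaves every free row free. *)
rewrite (big_pred1 [ffun => None]) => [|c].
  by apply: eq_bigr => i _; rewrite ffunE /cell_val /= mul1r andbT.
by rewrite andbT /=; case: eqP => [->|] //; rewrite column_ok_empty.
Qed.

(** In a free row, an empty box keeps the row free (z) and a beta or delta ends its freedom (b),
    both without constraint above; an alpha or gamma gives a z and empties the boxes above. Any
    other row must receive an empty box. *)
Lemma column_sum_recr z m fr :
  column_sum z m.+1 fr =
  if fr m then (z + b) * column_sum z m fr + a * z * free_prod z m fr
  else column_sum z m fr.
Proof.
rewrite /column_sum -(eq_bigl _ _ (fun c => andbT (column_ok fr c))).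
rewrite (sum_column_extend z m fr predT) -/(column_sum z m fr).
rewrite big_mkcond sum_option_label /cell_val /=.
case: (fr m) => /=; rewrite ?implybT ?implybF /= /blocks_up /blocks_left /=.
  by ring.
by ring.
Qed.

(** Solving for [column_sum] would require dividing by b. With C the column sum and F the free
    product, the combination b C + a z F is instead an eigenvector of the recursion: a free row
    turns it into b ((z + b) C + a z F) + a z (z F) = (z + b) (b C + a z F), and any other row
    leaves it unchanged. *)
Lemma column_sum_closed z m fr :
  b * column_sum z m fr + a * z * free_prod z m fr =
  (b + a * z) * free_prod (z + b) m fr.
Proof.
elim: m => [|m IH].
  rewrite /free_prod !big_ord0 /column_sum (big_pred1 [ffun => None]).
    by rewrite big_ord0; ring.
  move=> c; have -> : c = [ffun => None] by apply/ffunP; case.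
  by rewrite column_ok_empty /= eqxx.
rewrite column_sum_recr /free_prod !big_ord_recr -!/(free_prod _ _ _) /=.
case: (fr m); last by rewrite !mulr1.
rewrite [RHS]mulrA -IH; ring.
Qed.

(** A beta or delta at the bottom contributes b times the column sum above it, an alpha or gamma a z
    times the empty column: exactly the left side of [column_sum_closed]. *)
Lemma sum_diagonal_column z m (fr : nat -> bool) :
  fr m ->
  \sum_(c : {ffun 'I_m.+1 -> option label}
          | column_ok fr c && (c ord_max != None))
     \prod_(i < m.+1) cell_val z (fr i) (c i) =
  (b + a * z) * free_prod (z + b) m fr.
Proof.
move=> frm; rewrite (sum_column_extend z m fr (fun x => x != None)).
rewrite -column_sum_closed big_mkcond sum_option_label /cell_val frm /=.
by rewrite /blocks_up /blocks_left /=; ring.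
Qed.

End AtOne.

(** * Splitting off the leftmost column of the staircase *)

Section AddColumn.

Variable n : nat.

Lemma first_column_subproof (i : 'I_n.+1) :
  in_staircase (i, ord0 : 'I_n.+1).
Proof. by rewrite /in_staircase /= addn0. Qed.

Definition first_column (i : 'I_n.+1) : box n.+1 :=
  exist _ (i, ord0) (first_column_subproof i).

Lemma shift_box_subproof (b : box n) :
  in_staircase (widen_ord (leqnSn n) (val b).1, lift ord0 (val b).2).
Proof. by case: b => p; rewrite /in_staircase /= /bump add1n addnS. Qed.

Definition shift_box (b : box n) : box n.+1 :=
  exist _ (widen_ord (leqnSn n) (val b).1, lift ord0 (val b).2)
    (shift_box_subproof b).

Lemma brow_first i : brow (first_column i) = i. Proof. by []. Qed.
Lemma bcol_first i : bcol (first_column i) = 0%N. Proof. by []. Qed.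
Lemma brow_shift b : brow (shift_box b) = brow b. Proof. by []. Qed.
Lemma bcol_shift b : bcol (shift_box b) = (bcol b).+1. Proof. by []. Qed.

Lemma box_inj k (b b' : box k) : brow b = brow b' -> bcol b = bcol b' -> b = b'.
Proof.
move=> hr hc; apply: val_inj; move: hr hc; rewrite /brow /bcol.
by case: (val b) (val b') => [i j] [i' j'] /= /val_inj -> /val_inj ->.
Qed.

Lemma brow_lt k (b : box k) : (brow b < k)%N. Proof. exact: ltn_ord. Qed.

Lemma shift_box_inj : injective shift_box.
Proof.
move=> b b' e; apply: box_inj; first by rewrite -!brow_shift e.
by apply: succn_inj; rewrite -!bcol_shift e.
Qed.

Definition join_box (s : 'I_n.+1 + box n) : box n.+1 :=
  match s with inl i => first_column i | inr b => shift_box b end.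

Definition split_box (b : box n.+1) : 'I_n.+1 + box n :=
  if [pick b' | shift_box b' == b] is Some b' then inr b' else inl (val b).1.

Lemma join_boxK : cancel join_box split_box.
Proof.
case=> [i|b]; rewrite /split_box; case: pickP => [b' /eqP|] //=.
- by move/shift_box_inj ->.
- by move/(_ b); rewrite eqxx.
Qed.

Lemma split_boxK : cancel split_box join_box.
Proof.
move=> b; rewrite /split_box; case: pickP => [b' /eqP|] //= h.
case: b h => -[i j] ij h; apply: box_inj => //=.
case: (unliftP ord0 j) => [j' jE|j0]; last by rewrite [RHS]/bcol /= j0.
(* If the column index were nonzero, the box would be the shift of the box (i, j'), against [h]. *)
have lij : (i + j' < n)%N.
  by move: (ij); rewrite /in_staircase jE /= /bump add1n addnS.
have := h (exist _ (Ordinal (leq_ltn_trans (leq_addr _ _) lij), j') lij).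
by case/eqP; apply: box_inj; rewrite ?bcol_shift /bcol //= jE.
Qed.

Lemma join_box_bij : bijective join_box.
Proof. exact: Bijective join_boxK split_boxK. Qed.

Lemma prod_box_recl (R : comPzSemiRingType) (F : box n.+1 -> R) :
  \prod_b F b = \prod_i F (first_column i) * \prod_b F (shift_box b).
Proof.
by rewrite (reindex join_box) ?big_sumType //=; apply/onW_bij/join_box_bij.
Qed.

Lemma forall_box_recl (P : pred (box n.+1)) :
  [forall b, P b] =
  [forall i, P (first_column i)] && [forall b, P (shift_box b)].
Proof.
rewrite !forall_big_andE (reindex join_box) ?big_sumType //=.
exact/onW_bij/join_box_bij.
Qed.

Definition add_column (T : filling n) (c : {ffun 'I_n.+1 -> option label}) :
    filling n.+1 :=
  [ffun b => match split_box b with inl i => c i | inr b' => T b' end].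

Lemma add_column_first T c i : add_column T c (first_column i) = c i.
Proof. by rewrite ffunE (join_boxK (inl i)). Qed.

Lemma add_column_shift T c b : add_column T c (shift_box b) = T b.
Proof. by rewrite ffunE (join_boxK (inr b)). Qed.

Lemma sum_add_column (R : nmodType) (F : filling n.+1 -> R) :
  \sum_T F T = \sum_T \sum_c F (add_column T c).
Proof.
rewrite pair_big /= (reindex (fun p => add_column p.1 p.2)) //=.
exists (fun T : filling n.+1 =>
          ([ffun b => T (shift_box b)], [ffun i => T (first_column i)])).
  case=> T c _ /=; congr (_, _); apply/ffunP=> b; rewrite ffunE.
    exact: add_column_shift.
  exact: add_column_first.
move=> T _ /=; apply/ffunP=> b; rewrite -[b]split_boxK.
case: (split_box b) => [i|b'] /=.
  by rewrite add_column_first ffunE.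
by rewrite add_column_shift ffunE.
Qed.

End AddColumn.

(** * Free rows and the tableau conditions *)

Definition free_row n (T : filling n) (i : nat) : bool :=
  [forall b, (brow b == i) ==> ~~ blocks_left (T b)].

(** Row [n] lies below [T] and holds only the new diagonal box, which may therefore take any
    label. *)
Lemma free_row_out n (T : filling n) : free_row T n.
Proof.
by apply/forallP => b; rewrite (ltn_eqF (brow_lt b)).
Qed.

Lemma free_row_add_column n (T : filling n) c (i : 'I_n.+1) :
  free_row (add_column T c) i = free_row T i && ~~ blocks_left (c i).
Proof.
rewrite /free_row forall_box_recl andbC; congr (_ && _).
  by apply: eq_forallb => b; rewrite add_column_shift brow_shift.
apply/forallP/idP => [/(_ i)|h k]; first by rewrite add_column_first eqxx.
rewrite add_column_first; apply/implyP=> /eqP ki.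
by have -> : k = i by exact: val_inj.
Qed.

Lemma tableau_add_column n (T : filling n) c :
  is_staircase_tableau (add_column T c) =
  is_staircase_tableau T && (column_ok (free_row T) c && (c ord_max != None)).
Proof.
rewrite /is_staircase_tableau /column_ok.
set D := [forall b, on_diagonal b ==> (T b != None)].
set L := [forall b, forall b', _ ==> (T b' == None)].
set U := [forall b, forall b', _ ==> (T b' == None)].
set Cf := [forall i, (c i != None) ==> _].
set Cu := [forall k, forall i : 'I_n.+1, _ ==> (c i == None)].
have -> : [forall b, on_diagonal b ==> (add_column T c b != None)] =
          (c ord_max != None) && D.
  rewrite forall_box_recl; congr (_ && _).
    apply/forallP/idP => [/(_ ord_max)|h i].
      by rewrite add_column_first /on_diagonal brow_first bcol_first addn0 /= eqxx.
    rewrite add_column_first /on_diagonal brow_first bcol_first addn0 /=.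
    by apply/implyP=> /eqP e; have -> : i = ord_max by exact: val_inj.
  apply: eq_forallb => b.
  rewrite add_column_shift /on_diagonal brow_shift bcol_shift /= addnS.
  (* The existence of [b] excludes [n = 0], where the truncated [n.-1] would break the match of the
     two diagonals. *)
  have n_gt0 : (0 < n)%N by exact: leq_trans (brow_lt b).
  by rewrite -[X in _.+1 == X](prednK n_gt0) eqSS.
have -> : [forall b, forall b',
     [&& brow b' == brow b, (bcol b' < bcol b)%N
       & add_column T c b \in [:: Some Beta; Some Delta]]
     ==> (add_column T c b' == None)] = Cf && L.
  rewrite forall_box_recl.
  have -> /= : [forall i, forall b',
     [&& brow b' == brow (first_column i), (bcol b' < bcol (first_column i))%N
       & add_column T c (first_column i) \in [:: Some Beta; Some Delta]]
     ==> (add_column T c b' == None)].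
    by apply/forallP=> i; apply/forallP=> b'; rewrite ltn0 andbF.
  under eq_forallb => b do rewrite forall_box_recl.
  (* Contraposition: a beta or delta of [T] empties the new box of its row if and only if a labeled
     new box requires its row to be free. *)
  apply/forallP/andP => [h|[/forallP hf /forallP hl] b].
    split; apply/forallP => i; last first.
      have /andP[_ /forallP h2] := h i; apply/forallP=> b'; have := h2 b'.
      by rewrite !add_column_shift !brow_shift !bcol_shift ltnS.
    apply/implyP => ci; apply/forallP => b; apply/implyP => /eqP bi.
    have /andP[/forallP/(_ i) h1 _] := h b; apply: contra ci => bl.
    apply: (implyP _ bl); move: h1.
    by rewrite add_column_first add_column_shift brow_first brow_shift bi eqxx.
  apply/andP; split; apply/forallP=> b'; last first.
    have /forallP/(_ b') := hl b.
    by rewrite !add_column_shift !brow_shift !bcol_shift ltnS.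
  rewrite add_column_first add_column_shift brow_first brow_shift.
  apply/implyP => /and3P[/eqP e _ bl]; apply/negPn/negP => ci.
  have /forallP/(_ b) := implyP (hf b') ci.
  by rewrite -e eqxx /= /blocks_left bl.
have -> : [forall b, forall b',
     [&& bcol b' == bcol b, (brow b' < brow b)%N
       & add_column T c b \in [:: Some Alpha; Some Gamma]]
     ==> (add_column T c b' == None)] = Cu && U.
  (* Old and new boxes never share a column, so the mixed cases are vacuous. *)
  rewrite forall_box_recl; congr (_ && _); apply: eq_forallb => b.
    rewrite forall_box_recl [X in _ && X](_ : _ = true) ?andbT.
      by apply: eq_forallb => i; rewrite !add_column_first !bcol_first.
    by apply/forallP => b'; rewrite bcol_shift.
  rewrite forall_box_recl [X in X && _](_ : _ = true) /=.
    apply: eq_forallb => b'.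
    by rewrite !add_column_shift !bcol_shift eqSS !brow_shift.
  exact/forallP.
by case: D; case: L; case: U; case: Cf; case: Cu; case: (c ord_max != None).
Qed.

(** * The recurrence on the size and its solution *)

Section Recurrence.

Variables (R : comNzRingType) (alpha beta gamma delta : R).

Local Notation a := (alpha + gamma).
Local Notation b := (beta + delta).
Local Notation val_of := (content_val alpha beta gamma delta).

Definition free_row_sum n (z : R) : R :=
  \sum_(T : filling n | is_staircase_tableau T)
     (\prod_p val_of (T p)) * free_prod z n (free_row T).

(** For each fixed [T] the sum over the new column turns every factor z of a free row into z + b:
    the row stays free or receives a beta or delta. *)
Lemma free_row_sumS n z :
  free_row_sum n.+1 z = (b + a * z) * free_row_sum n (z + b).
Proof.
rewrite /free_row_sum big_mkcond sum_add_column [X in _ * X]big_mkcond.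
rewrite big_distrr /=; apply: eq_bigr => T _.
under eq_bigr => c _ do rewrite tableau_add_column.
case: (is_staircase_tableau T) => /=; last by rewrite big1 ?mulr0.
rewrite mulrCA -sum_diagonal_column ?free_row_out //.
rewrite -big_mkcond big_distrr /=; apply: eq_bigr => c _.
rewrite prod_box_recl mulrAC mulrC; congr (_ * _).
  by apply: eq_bigr => p _; rewrite add_column_shift.
rewrite /free_prod -big_split /=; apply: eq_bigr => i _.
by rewrite add_column_first free_row_add_column.
Qed.

(** The induction keeps z general, since each added column shifts it by b. *)
Lemma free_row_sumE n z :
  free_row_sum n z = \prod_(0 <= j < n) (b + a * (z + j%:R * b)).
Proof.
elim: n z => [|n IH] z.
  have noT (T : filling 0) : T = [ffun => None] by apply/ffunP; case=> -[[]].
  rewrite big_geq // /free_row_sum (big_pred1 [ffun => None]).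
    rewrite /free_prod big_ord0 mulr1 big1 // => p _.
    by rewrite ffunE.
  move=> T; rewrite (noT T) /= eqxx.
  by apply/and3P; split; apply/forallP; case=> -[[]].
rewrite free_row_sumS IH big_nat_recl //; congr (_ * _).
  by rewrite mul0r addr0.
by apply: eq_bigr => j _; rewrite -natr1; ring.
Qed.

Lemma empty_val1 (r s : option label) : empty_val (1 : R) r s = 1.
Proof. by case: r => [[]|] //; case: s => [[]|]. Qed.

Lemma Z_free_row_sum n :
  Z 1 alpha beta gamma delta 1 n = free_row_sum n 1.
Proof.
apply: eq_bigr => T _; rewrite expr1n /free_prod [X in _ = _ * X]big1 => [|i _].
  by rewrite !mulr1; apply: eq_bigr => p _; case: (T p) => //=; rewrite empty_val1.
by case: ifP.
Qed.

End Recurrence.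

Theorem theorem4p1 (R : comNzRingType) (alpha beta gamma delta : R) (n : nat)
    (hn : (1 <= n)%N) :
  Z 1 alpha beta gamma delta 1 n =
  \prod_(0 <= j < n)
    (alpha + beta + gamma + delta
     + j%:R * (alpha + gamma) * (beta + delta)).
Proof.
(* At z = 1 the factor is b + a (1 + j b) = a + b + j a b. *)
rewrite Z_free_row_sum free_row_sumE; apply: eq_bigr => j _; ring.
Qed.
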